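(* Let $f\in C([0,1]^n)$ be nonnegative, and for $h>0$ let $w_h$ be the maximal solution of the scheme (S3). Then $w_h\to w$ uniformly on $(0,1]^n$ as $h\to0$, where $w$ is the maximal bounded viscosity solution of (P3); that is, $\max_{x\in(0,1]^n_h}|w_h(x)-w(x)|\to0$ as $h\to0$.
   Context: $n\ge1$ is an integer, $a_+=\max(a,0)$, and $\Gamma=\partial[0,1]^n\setminus(0,1]^n$. A function is nondecreasing if it is nondecreasing in each coordinate separately. Grid: for $h>0$, $\mathbb{Z}_h=\{hk:k\in\mathbb{Z}\}$, $\Omega_h=\Omega\cap(\mathbb{Z}_h)^n$, and $D_i^-g(x)=\dfrac{g(x)-g(x-he_i)}{h}$. Problem (P1): $(u_{x_1})_+\cdots(u_{x_n})_+=f$ in $(0,1]^n$, $u=0$ on $\Gamma$. A viscosity solution of (P1) is a continuous $u:[0,1]^n\to\mathbb{R}$ with $u=0$ on $\Gamma$ such that for every $x_0\in(0,1]^n$ and every $C^1$ function $\phi$: if $u-\phi$ has a local maximum (resp. minimum) at $x_0$ relative to $(0,1]^n$, then $\prod_i(\phi_{x_i}(x_0))_+\le f(x_0)$ (resp. $\ge f(x_0)$). For continuous nonnegative $f$ there is a unique nondecreasing viscosity solution $u$ of (P1). Problem (P3): $\prod_{i=1}^n(w+nx_iw_{x_i})_+=f$ on $(0,1]^n$ (no boundary condition). The maximal bounded viscosity solution of (P3) is by definition $w(x)=n^{-1}(x_1\cdots x_n)^{-1/n}u(x)$, $x\in(0,1]^n$, where $u$ is the nondecreasing viscosity solution of (P1).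 Scheme (S3): $\prod_{i=1}^n\big(w_h(x)+nx_iD_i^-w_h(x)\big)_+=f(x)$ for all $x\in[0,1]^n_h$, where the term $nx_iD_i^-w_h(x)$ is interpreted as $0$ when $x_i=0$. The maximal solution $w_h:[0,1]^n_h\to[0,\infty)$ is defined inductively: at each $x$, given the values $w_h(x-he_i)$ for those $i$ with $x_i\neq0$, $w_h(x)$ is the largest real number satisfying the equation at $x$. *)

(* Defs.v *)
From HB Require Import structures.
From mathcomp Require Export all_boot all_order all_algebra.
From mathcomp Require Export all_classical all_reals all_analysis.
Export Order.TTheory GRing.Theory Num.Theory.
Export numFieldNormedType.Exports.

Set Implicit Arguments.
Unset Strict Implicit.
Unset Printing Implicit Defensive.

Local Open Scope classical_set_scope.
Local Open Scope ring_scope.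

(* Functions on [0,1]^n or on a grid are represented by total functions on
   'rV[R]_n; every definition below only uses their values on the relevant
   domain. *)

Section Domains.
Context {R : realType} (n : nat).
Implicit Types (x : 'rV[R]_n).

Definition unit_vec (i : 'I_n) : 'rV[R]_n := delta_mx 0 i.

Definition closed_cube : set 'rV[R]_n :=
  [set x | forall i, 0 <= x 0 i <= 1].

Definition half_open_cube : set 'rV[R]_n :=
  [set x | forall i, 0 < x 0 i <= 1].

Definition topological_boundary (A : set 'rV[R]_n) : set 'rV[R]_n :=
  closure A `\` interior A.

Definition Gamma : set 'rV[R]_n :=
  topological_boundary closed_cube `\` half_open_cube.

Definition lattice (h : R) : set 'rV[R]_n :=
  [set x | forall i, exists k : int, x 0 i = h * k%:~R].

Definition grid (Omega : set 'rV[R]_n) (h : R) : set 'rV[R]_n :=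
  Omega `&` lattice h.

End Domains.

Arguments closed_cube {R n}.
Arguments half_open_cube {R n}.
Arguments Gamma {R n}.

Definition pos_part {R : realType} (a : R) : R := Num.max a 0.

Section ContinuousProblem.
Context {R : realType} (n : nat).
Implicit Types (f u w phi : 'rV[R]_n -> R) (x : 'rV[R]_n).

Definition nondecreasing_coordinatewise u : Prop :=
  forall (i : 'I_n) x y, closed_cube x -> closed_cube y ->
    (forall j, j != i -> x 0 j = y 0 j) -> x 0 i <= y 0 i -> u x <= u y.

Definition partial (i : 'I_n) phi x : R := 'D_(unit_vec i) phi x.

Definition continuously_differentiable phi : Prop :=
  forall i : 'I_n,
    (forall x, derivable phi x (unit_vec i)) /\ continuous (partial i phi).

Definition local_max_within (A : set 'rV[R]_n) (g : 'rV[R]_n -> R) x0 : Prop :=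
  \forall x \near within A (nbhs x0), g x <= g x0.

Definition local_min_within (A : set 'rV[R]_n) (g : 'rV[R]_n -> R) x0 : Prop :=
  \forall x \near within A (nbhs x0), g x0 <= g x.

Definition P1_operator phi x : R := \prod_(i < n) pos_part (partial i phi x).

Definition P1_viscosity_solution f u : Prop :=
  [/\ {within closed_cube, continuous u},
      (forall x, Gamma x -> u x = 0),
      (forall x0 phi, half_open_cube x0 -> continuously_differentiable phi ->
         local_max_within half_open_cube (fun x => u x - phi x) x0 ->
         P1_operator phi x0 <= f x0) &
      (forall x0 phi, half_open_cube x0 -> continuously_differentiable phi ->
         local_min_within half_open_cube (fun x => u x - phi x) x0 ->
         f x0 <= P1_operator phi x0)].

(* The maximal bounded viscosity solution of
     \prod_i (w + n x_i w_{x_i})_+ = f on (0,1]^n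
   is by definition the following transform of the (unique) nondecreasing
   viscosity solution u of \prod_i (u_{x_i})_+ = f, u = 0 on Gamma. *)
Definition P3_maximal_solution f w : Prop :=
  exists u, [/\ P1_viscosity_solution f u,
    nondecreasing_coordinatewise u &
    forall x, half_open_cube x ->
      w x = n%:R^-1 * (\prod_(i < n) x 0 i) `^ (- n%:R^-1) * u x].

End ContinuousProblem.

Section Scheme.
Context {R : realType} (n : nat) (h : R).
Implicit Types (f g w : 'rV[R]_n -> R) (x : 'rV[R]_n).

Definition backward_diff (i : 'I_n) g x : R :=
  (g x - g (x - h *: unit_vec i)) / h.

Definition S3_operator g x : R :=
  \prod_(i < n) pos_part
    (g x + if x 0 i == 0 then 0 else n%:R * x 0 i * backward_diff i g x).

(* [[eta w with x |-> t]] keeps the values of [w] at the points x - h e_i and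
   replaces its value at x by t: w x has to be the largest t that solves the
   equation at x. By induction on the grid this determines w on the grid. *)
Definition S3_maximal_solution f w : Prop :=
  forall x, grid closed_cube h x ->
    [/\ 0 <= w x, S3_operator w x = f x &
        forall t : R, S3_operator [eta w with x |-> t] x = f x -> t <= w x].

End Scheme.

(* Main.v *)
Require Import Defs.
From mathcomp Require Import ring lra.

Set Implicit Arguments.
Unset Strict Implicit.
Unset Printing Implicit Defensive.

Local Open Scope classical_set_scope.
Local Open Scope ring_scope.

(** The transformed solution w = u / (n (x_1 ... x_n)^(1/n)) solves
    prod_i (w + n x_i w_{x_i})_+ = f, and the scheme is a monotone
    discretization of that equation.  The two are compared by doubling
    variables: maximize wh(x) - w(y) - |x - y|^2 / (2 e) over grid points x and
    points y of the cube.  At a maximum both functions see the slope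
    (x_i - y_i) / e, up to O(h / e), so their transport terms differ by
    n (x_i - y_i)^2 / e.  This has the favourable sign, because the field
    x_i d/dx_i is monotone.  A gap eta between wh and w therefore makes every
    factor of the scheme exceed the matching factor of the equation by eta / 4.
    These factors are nonnegative, on the continuous side because u is
    nondecreasing and on the discrete side because wh is maximal; so the two
    products, which are values of f at nearby points, differ by at least
    (eta / 4)^n.  Uniform continuity of f forbids this once e is small
    ([doubling_upper], [doubling_lower]).  That x and y are close only takes
    bounds on wh and w, not a modulus of continuity, which is why the estimate
    is uniform up to Gamma although no boundary values of w are known.

    To have a maximum on the closed cube, w is replaced by
    (u + th) / (n ((y_1 + k) ... (y_n + k))^(1/n)).  It solves the same equation
    exactly, with y_i + k in place of y_i as the coefficient of the derivative,
    at the price of an error n k / e in the doubling.  For th = 0 it vanishes on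
    the faces y_i = 0, so that no maximum of w - wh can lie there; for th > 0
    and k much smaller than th it is larger than wh on the faces, so that no
    maximum of wh - w can lie there.  The order of choices is e from eta, then h
    from e, then th and k from h and the given grid point.

    Test functions have to be C^1 on the whole space, whereas the geometric mean
    is not.  Touching it by its tangent plane from above (the inequality of
    means) and by a concave parabola from below makes products of two
    polynomials suffice ([regularized_subsolution],
    [regularized_supersolution]). *)

(** * Geometric means and products *)

Section Means.
Context {R : realType} (n : nat).
Implicit Types (r A : 'I_n -> R).

Lemma geometric_mean_le r (n_ge1 : (1 <= n)%N) (r_ge0 : forall i, 0 <= r i) :
  (\prod_i r i) `^ n%:R^-1 <= (\sum_i r i) / n%:R.
Proof.
have n0 : n%:R != 0 :> R by rewrite pnatr_eq0 -lt0n.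
have S0 : 0 <= (\sum_i r i) / n%:R by rewrite divr_ge0// sumr_ge0.
have := (@leif_AGM R 'I_n predT r (fun i _ => r_ge0 i)).1.
rewrite cardT size_enum_ord => agm.
have -> : (\sum_i r i) / n%:R = (((\sum_i r i) / n%:R) ^+ n) `^ n%:R^-1.
  by rewrite -powR_mulrn// -powRrM mulfV// powRr1.
by apply: ge0_ler_powR => //; rewrite ?nnegrE ?invr_ge0 ?exprn_ge0 ?prodr_ge0.
Qed.

(** A lower counterpart of the inequality of means.  Applied to the inverses, that
    inequality bounds the geometric mean P below through 2 - 1/P <= P; the
    hypothesis 1/2 <= r i is what makes 1 - 1/r >= (r - 1) - 2 (r - 1)^2. *)
Lemma geometric_mean_ge r (n_ge1 : (1 <= n)%N)
    (r_ge : forall i, 2^-1 <= r i) :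
  1 + \sum_i ((r i - 1) / n%:R - 2 / n%:R * (r i - 1) ^+ 2)
    <= (\prod_i r i) `^ n%:R^-1.
Proof.
have r_gt0 i : 0 < r i by apply: lt_le_trans (r_ge i); rewrite invr_gt0.
have n0 : 0 < n%:R :> R by rewrite ltr0n.
have P0 : 0 < \prod_i r i by rewrite prodr_gt0.
set P := (\prod_i r i) `^ n%:R^-1.
have Pp : 0 < P by rewrite powR_gt0.
have := @geometric_mean_le (fun i => (r i)^-1) n_ge1.
rewrite prodfV (_ : (_^-1) `^ _ = P^-1); last first.
  rewrite /P -powRN -powR_inv1 ?(ltW P0)//.
  by rewrite -powRrM mulN1r.
move=> /(_ (fun i => ltW (etrans (invr_gt0 _) (r_gt0 i)))) agm.
(* the convex function 1/P lies above its tangent at 1 *)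
have tangent : 2 - P^-1 <= P.
  rewrite -subr_ge0 (_ : _ - _ = (P - 1) ^+ 2 / P); last by field; lra.
  by rewrite divr_ge0// ?sqr_ge0// ltW.
apply: le_trans tangent; rewrite lerBrDr.
apply: (le_trans (lerD (lexx _) agm)).
rewrite -addrA mulr_suml -big_split/= -lerBrDl.
rewrite (_ : 2 - 1 = \sum_(i < n) n%:R^-1); last first.
  rewrite sumr_const card_ord -[RHS]mulr_natl mulfV ?gt_eqF//.
  by rewrite -[2]/(1 + 1) addrK.
apply: ler_sum => i _; rewrite -subr_ge0.
rewrite (_ : _ - _ = n%:R^-1 * ((r i - 1) ^+ 2 * (2 * r i - 1) / r i)).
  have ri : 0 <= 2 * r i - 1.
    by rewrite subr_ge0 -ler_pdivrMl// mulr1.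
  apply: mulr_ge0; first by rewrite invr_ge0 ltW.
  apply: divr_ge0; last exact: ltW.
  by apply: mulr_ge0; first exact: sqr_ge0.
by field; rewrite ?gt_eqF.
Qed.

(** Nonnegativity of the factors turns a gap d in each of them into a definite gap
    in the product, even where the product itself vanishes. *)
Lemma prod_add_ge A d (n_ge1 : (1 <= n)%N) (A_ge0 : forall i, 0 <= A i)
    (d_ge0 : 0 <= d) : \prod_i A i + d ^+ n <= \prod_i (A i + d).
Proof.
case: n A A_ge0 n_ge1 => // m A A_ge0 _.
elim: m A A_ge0 => [|m IH] A A_ge0; first by rewrite !big_ord1 expr1.
rewrite big_ord_recl [leRHS]big_ord_recl/= exprS.
have := IH (fun i => A (lift ord0 i)) (fun i => A_ge0 _).
set P := \prod_(i < m.+1) _; set Q := \prod_(i < m.+1) (_ + _) => PQ.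
have P0 : 0 <= P by rewrite prodr_ge0.
have e0 : 0 <= d ^+ m.+1 by rewrite exprn_ge0.
have := A_ge0 ord0; nra.
Qed.

End Means.

(** * Quadratic test polynomials *)

Section Polynomials.
Context {R : realType} (n : nat).
Implicit Types (a b : 'I_n -> R) (x y z : 'rV[R]_n).

(** Separable, so that partial derivatives reduce to one coordinate; [z] is the
    point at which the polynomial is centred, with value [c] and gradient [a]. *)
Definition quad c a b z y : R :=
  c + \sum_i (a i * (y 0 i - z 0 i) + b i * (y 0 i - z 0 i) ^+ 2).

Lemma quad_center c a b z : quad c a b z z = c.
Proof.
rewrite /quad big1 ?addr0// => i _.
by rewrite subrr expr0n/= !mulr0 addr0.
Qed.

Lemma cvg_coordB i y z :
  (fun t : 'rV[R]_n => t 0 i - z 0 i) @ y --> y 0 i - z 0 i.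
Proof. exact: cvgB (@coord_continuous R 1 n 0 i y) (cvg_cst _). Qed.

Lemma continuous_quad c a b z : continuous (quad c a b z).
Proof.
move=> y.
have cs : (fun t : 'rV[R]_n =>
      \sum_(i < n) (a i * (t 0 i - z 0 i) + b i * (t 0 i - z 0 i) ^+ 2))
    @ y -->
    \sum_(i < n) (a i * (y 0 i - z 0 i) + b i * (y 0 i - z 0 i) ^+ 2).
  apply: (cvg_big (P := xpredT) add_continuous (nbhs_filter y)) => i _.
  have co := @cvg_coordB i y z.
  exact: cvgD (cvgM (cvg_cst _) co) (cvgM (cvg_cst _) (cvgM co co)).
exact: cvgD (cvg_cst _) cs.
Qed.

Lemma is_derive_coord x v (i : 'I_n) :
  is_derive x v (fun y : 'rV[R]_n => y 0 i) (v 0 i).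
Proof.
have dv : derivable (@id 'rV[R]_n) x v by exact: derivable_id.
apply: DeriveDef; first by move/derivable_mxP : dv => /(_ 0 i).
have := derive_mx dv; rewrite derive_id => /matrixP /(_ 0 i).
by rewrite mxE => ->.
Qed.

Lemma is_derive_quad c a b z y (i : 'I_n) :
  is_derive y (unit_vec i) (quad c a b z)
    (a i + 2 * b i * (y 0 i - z 0 i)).
Proof.
pose g (j : 'I_n) (y : 'rV[R]_n) : R :=
  a j * (y 0 j - z 0 j) + b j * (y 0 j - z 0 j) ^+ 2.
have -> : quad c a b z = cst c + \sum_(j < n) g j.
  by apply/funext => t; rewrite /quad fctE/= fct_sumE.
have dg j : is_derive y (unit_vec i) (g j)
   (if j == i then a i + 2 * b i * (y 0 i - z 0 i) else 0).
  have dc : is_derive y (unit_vec i) (fun y : 'rV[R]_n => y 0 j - z 0 j)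
      (j == i)%:R.
    have -> : (fun y : 'rV[R]_n => y 0 j - z 0 j)
        = (fun y : 'rV[R]_n => y 0 j) + cst (- z 0 j) by [].
    have := is_derive_coord y (unit_vec i) j.
    rewrite /unit_vec mxE eqxx/= => dj.
    by apply: is_derive_eq; rewrite subr0.
  have -> : g j = (a j \*o (fun y : 'rV[R]_n => y 0 j - z 0 j))
    + (b j \*o ((fun y : 'rV[R]_n => y 0 j - z 0 j) *
               (fun y : 'rV[R]_n => y 0 j - z 0 j))).
    by apply/funext => t; rewrite /g/= fctE/= expr2.
  apply: is_derive_eq.
  by case: eqP => [->|_]; rewrite /GRing.scale/= ?mulr1 ?mulr0; ring.
apply: is_derive_eq.
by rewrite add0r (bigD1 i)//= eqxx big1 ?addr0// => j /negbTE ->.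
Qed.

Lemma partial_mul_quadE c a b c' a' b' z i :
  partial i (fun y => quad c a b z y * quad c' a' b' z y) =
  (fun y => quad c a b z y * (a' i + 2 * b' i * (y 0 i - z 0 i)) +
            quad c' a' b' z y * (a i + 2 * b i * (y 0 i - z 0 i))).
Proof.
apply/funext => y.
have d := is_derive_quad c a b z y i; have d' := is_derive_quad c' a' b' z y i.
rewrite /partial (_ : (fun _ => _) = quad c a b z * quad c' a' b' z)//.
by rewrite derive_val.
Qed.

Lemma mul_quad_C1 c a b c' a' b' z :
  continuously_differentiable (fun y => quad c a b z y * quad c' a' b' z y).
Proof.
move=> i; split=> [y|].
  have [d _] := is_derive_quad c a b z y i.
  have [d' _] := is_derive_quad c' a' b' z y i.
  exact: derivableM d d'.
rewrite partial_mul_quadE => y.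
have lin e e' : (fun t : 'rV[R]_n => e + e' * (t 0 i - z 0 i)) @ y
    --> e + e' * (y 0 i - z 0 i).
  exact: cvgD (cvg_cst _) (cvgM (cvg_cst _) (@cvg_coordB i y z)).
exact: cvgD (cvgM (@continuous_quad c a b z y) (lin _ _))
            (cvgM (@continuous_quad c' a' b' z y) (lin _ _)).
Qed.

Lemma partial_mul_quad c a b c' a' b' z i :
  partial i (fun y => quad c a b z y * quad c' a' b' z y) z
    = c * a' i + c' * a i.
Proof.
by rewrite partial_mul_quadE !quad_center subrr !mulr0 !addr0.
Qed.

End Polynomials.

(** * The cube and its faces *)

Section Cube.
Context {R : realType} (n : nat).
Implicit Types (u : 'rV[R]_n -> R) (x y z : 'rV[R]_n).

Lemma half_open_sub_closed : @half_open_cube R n `<=` closed_cube.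
Proof. by move=> x xc i; have /andP[/ltW -> ->] := xc i. Qed.

Lemma closed_half_open_or_zero x : closed_cube x ->
  half_open_cube x \/ exists i, x 0 i = 0.
Proof.
move=> xc; have [[i xi]|nz] := pselect (exists i, x 0 i = 0).
  by right; exists i.
left=> i; have /andP[x0 ->] := xc i; rewrite andbT lt_neqAle x0 andbT.
by apply/eqP => xi; apply: nz; exists i.
Qed.

Lemma shift_unit_vecE x h (i j : 'I_n) :
  (h *: unit_vec i + x) 0 j = x 0 j + h * (j == i)%:R :> R.
Proof. by rewrite !mxE eqxx/= addrC. Qed.

Lemma cvg_shift_unit_vec x (i : 'I_n) :
  (fun h : R => h *: unit_vec i + x) @ 0 --> x.
Proof.
rewrite -[X in _ --> X]add0r -(scale0r (unit_vec i)).
apply: (@cvgD _ _ _ _ _ (fun h : R => h *: unit_vec i) (cst x)); last first.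
  exact: cvg_cst.
by apply: cvgZr_tmp; exact: cvg_id.
Qed.

(** A face lies in the boundary because moving out of it leaves the cube. *)
Lemma Gamma_face x (i : 'I_n) : closed_cube x -> x 0 i = 0 -> Gamma x.
Proof.
move=> xc xi; split; last by move=> /(_ i); rewrite xi ltxx.
split; first exact: subset_closure.
move=> xI; have := @cvg_shift_unit_vec x i _ xI.
move=> /nbhs_ballP[e /= e0] /(_ (- (e / 2))).
rewrite /ball/= sub0r opprK gtr0_norm ?divr_gt0// ltr_pdivrMr//.
rewrite ltr_pMr// ltr1n => /(_ isT) /(_ i).
by rewrite shift_unit_vecE xi eqxx mulr1 add0r oppr_ge0 leNgt divr_gt0.
Qed.

Lemma compact_closed_cube : compact (@closed_cube R n).
Proof.
apply: (@rV_compact R n (fun=> `[0 : R, 1]%classic)) => _.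
exact: segment_compact.
Qed.

Lemma nondecreasing_ge0 u : (1 <= n)%N -> nondecreasing_coordinatewise u ->
  (forall x, Gamma x -> u x = 0) -> forall x, closed_cube x -> 0 <= u x.
Proof.
move=> n_ge1 u_nd u0 x xc; pose i0 := Ordinal n_ge1.
pose y : 'rV[R]_n := \row_j (if j == i0 then 0 else x 0 j).
have yc : closed_cube y.
  by move=> j; rewrite mxE; case: ifP => _; rewrite ?lexx ?ler01//; exact: xc.
rewrite -(u0 y); last by apply: (@Gamma_face _ i0) => //; rewrite mxE eqxx.
apply: (u_nd i0) => // [j /negbTE j0|]; first by rewrite mxE j0.
by rewrite mxE eqxx; have /andP[] := xc i0.
Qed.

(** A function touching a nondecreasing function from below does not increase
    when moving backwards in a coordinate; the left difference quotients stay available at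
    every point of the half-open cube. *)
Lemma partial_ge0_at_local_min u phi z (i : 'I_n) :
  nondecreasing_coordinatewise u -> half_open_cube z ->
  derivable phi z (unit_vec i) ->
  local_min_within half_open_cube (fun y => u y - phi y) z ->
  0 <= partial i phi z.
Proof.
move=> u_nd zc dphi zmin.
rewrite /partial /derive cvg_at_leftE//; apply: limr_ge.
  rewrite -cvg_at_leftE//.
  apply: cvg_trans dphi; apply: cvg_app.
  move=> A [e egt0 Ae]; exists e => // x xe xgt0; apply: Ae => //.
  exact/ltr0_neq0.
have near_min := @cvg_shift_unit_vec z i _ zmin.
have zi : 0 < z 0 i by have /andP[] := zc i.
near=> h.
have h0 : h < 0 by near: h; exact: nbhs_left_lt.
have hz : - z 0 i < h by near: h; apply: nbhs_left_gt; rewrite oppr_lt0.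
have yc : half_open_cube (h *: unit_vec i + z).
  move=> j; rewrite shift_unit_vecE; have [->|_] := eqVneq j i; last first.
    by rewrite mulr0 addr0; exact: zc.
  by rewrite mulr1; have /andP[_ z1] := zc i; apply/andP; split; lra.
have : u z - phi z <= u (h *: unit_vec i + z) - phi (h *: unit_vec i + z).
  by move: yc; near: h; apply: cvg_within; exact: near_min.
have : u (h *: unit_vec i + z) <= u z.
  apply: (u_nd i); [exact: half_open_sub_closed..| |] => [j /negbTE ji|].
    by rewrite shift_unit_vecE ji mulr0 addr0.
  by rewrite shift_unit_vecE eqxx mulr1; lra.
move=> ule uphi; apply: mulr_le0; first by rewrite invr_le0 ltW.
by rewrite /=; lra.
Unshelve. all: by end_near. Qed.

End Cube.

(** * The regularized solution and its equation *)

Section Regularized.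
Context {R : realType} (n : nat) (n_ge1 : (1 <= n)%N).
Implicit Types (u f phi : 'rV[R]_n -> R) (x y z : 'rV[R]_n) (k th : R).

(** The shift [k] keeps the geometric mean positive and smooth on the closed
    cube. *)
Definition shifted_mean k y : R := (\prod_(i < n) (y 0 i + k)) `^ n%:R^-1.

Definition regularized u th k y : R := (u y + th) / (n%:R * shifted_mean k y).

Let n_gt0 : 0 < n%:R :> R. Proof. by rewrite ltr0n. Qed.

Lemma shifted_coord_gt0 k y i : 0 < k -> closed_cube y -> 0 < y 0 i + k.
Proof. by move=> k0 /(_ i)/andP[y0 _]; rewrite ltr_wpDl. Qed.

Lemma shifted_prod_gt0 k y : 0 < k -> closed_cube y ->
  0 < \prod_(i < n) (y 0 i + k).
Proof. by move=> k0 yc; apply: prodr_gt0 => i _; exact: shifted_coord_gt0. Qed.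

Lemma shifted_mean_gt0 k y : 0 < k -> closed_cube y -> 0 < shifted_mean k y.
Proof. by move=> k0 yc; rewrite powR_gt0// shifted_prod_gt0. Qed.

Lemma shifted_mean_exp k y : 0 < k -> closed_cube y ->
  shifted_mean k y ^+ n = \prod_(i < n) (y 0 i + k).
Proof.
move=> k0 yc; rewrite -powR_mulrn ?powR_ge0// /shifted_mean -powRrM.
by rewrite mulVf ?gt_eqF// powRr1// ltW// shifted_prod_gt0.
Qed.

Lemma shifted_mean_ratio k y z : 0 < k -> closed_cube y -> closed_cube z ->
  shifted_mean k y = shifted_mean k z *
    (\prod_(i < n) ((y 0 i + k) / (z 0 i + k))) `^ n%:R^-1.
Proof.
move=> k0 yc zc; rewrite /shifted_mean -powRM; last 2 first.
- by rewrite ltW// shifted_prod_gt0.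
- by rewrite prodr_ge0// => i _; rewrite divr_ge0 ?ltW ?shifted_coord_gt0.
rewrite -big_split/=; congr (_ `^ _); apply: eq_bigr => i _.
by rewrite mulrC divfK// gt_eqF// shifted_coord_gt0.
Qed.

Let slope k z (i : 'I_n) : R := (n%:R * (z 0 i + k))^-1.

(** The geometric mean is concave; the inequality of means for the ratios
    (y_i + k) / (z_i + k) says that it lies below its tangent plane at [z]. *)
Lemma shifted_mean_le_tangent k y z :
  0 < k -> closed_cube y -> closed_cube z ->
  shifted_mean k y <= shifted_mean k z * quad 1 (slope k z) (fun=> 0) z y.
Proof.
move=> k0 yc zc; rewrite (shifted_mean_ratio k0 yc zc).
rewrite ler_pM2l ?shifted_mean_gt0//.
apply: le_trans (geometric_mean_le n_ge1 _) _ => [i|].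
  by rewrite divr_ge0 ?ltW ?shifted_coord_gt0.
rewrite /quad -[X in X + _](mulfV (lt0r_neq0 n_gt0)) -{1}[n in n%:R / _]card_ord.
rewrite -sumr_const !mulr_suml -big_split/= ler_sum// => i _.
have zi := shifted_coord_gt0 i k0 zc.
rewrite le_eqVlt; apply/orP; left; apply/eqP; rewrite /slope; field.
by rewrite !gt_eqF.
Qed.

(** The radius k / 2 is uniform in [z]: it keeps all the ratios
    (y_i + k) / (z_i + k) in [1/2, 3/2], also when [z] is close to a face. *)
Lemma shifted_mean_ge_parabola k y z :
  0 < k -> closed_cube y -> closed_cube z ->
  (forall i, `|y 0 i - z 0 i| <= k / 2) ->
  shifted_mean k z * quad 1 (slope k z)
      (fun i => - (2 / (n%:R * (z 0 i + k) ^+ 2))) z y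
  <= shifted_mean k y.
Proof.
move=> k0 yc zc close; rewrite (shifted_mean_ratio k0 yc zc).
rewrite ler_pM2l ?shifted_mean_gt0//.
apply: le_trans _ (geometric_mean_ge n_ge1 _) => [|i].
  rewrite lerD2l; apply: ler_sum => i _.
  have zi := shifted_coord_gt0 i k0 zc.
  rewrite le_eqVlt; apply/orP; left; apply/eqP; rewrite /slope; field.
  by rewrite !gt_eqF.
have zi := shifted_coord_gt0 i k0 zc.
rewrite ler_pdivlMr//; have /andP[z0 _] := zc i.
by have := close i; rewrite ler_norml => /andP[]; lra.
Qed.

Lemma parabola_ge0 k y z :
  0 < k -> closed_cube z -> (forall i, `|y 0 i - z 0 i| <= k / 2) ->
  0 <= quad 1 (slope k z) (fun i => - (2 / (n%:R * (z 0 i + k) ^+ 2))) z y.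
Proof.
move=> k0 zc close.
rewrite /quad -[X in X + _](mulfV (lt0r_neq0 n_gt0)) -{1}[n in n%:R / _]card_ord.
rewrite -sumr_const !mulr_suml -big_split/= sumr_ge0// => i _.
have zi := shifted_coord_gt0 i k0 zc.
set s := (y 0 i - z 0 i) / (z 0 i + k).
(* spreading 1 over the coordinates, each term is (1 + s - 2 s^2) / n *)
rewrite (_ : _ + _ = n%:R^-1 * ((1 - s) * (1 + 2 * s))); last first.
  by rewrite /slope /s; field; rewrite !gt_eqF.
have /andP[z0 _] := zc i.
have : `|s| <= 2^-1.
  rewrite normrM normfV (gtr0_norm zi) ler_pdivrMr//.
  by apply: le_trans (close i) _; lra.
rewrite ler_norml => /andP[s1 s2]; apply: mulr_ge0.
  by rewrite invr_ge0 ltW.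
by apply: mulr_ge0; lra.
Qed.

(** If [regularized] is touched at [z] by the quadratic with value [w], gradient
    [p] and second-order coefficients [c], then u + th is touched by n times the
    mean times that quadratic.  Here the mean is in turn replaced by a quadratic
    (of second-order coefficients [b]), which leaves the gradient at [z]
    unchanged and makes the product a polynomial. *)
Definition touching k w p c b z y : R :=
  quad 1 (slope k z) b z y *
  quad (n%:R * shifted_mean k z * w) (fun i => n%:R * shifted_mean k z * p i)
       (fun i => n%:R * shifted_mean k z * c i) z y.

Lemma touchingE k w p c b z y : touching k w p c b z y =
  n%:R * (shifted_mean k z * quad 1 (slope k z) b z y) * quad w p c z y.
Proof.
rewrite /touching (_ : quad (_ * w) _ _ _ _ =
  n%:R * shifted_mean k z * quad w p c z y); first by ring.
rewrite /quad mulrDr mulr_sumr; congr (_ + _); apply: eq_bigr => i _; ring.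
Qed.

Lemma partial_touching k w p c b z i : 0 < k -> closed_cube z ->
  partial i (touching k w p c b z) z =
  shifted_mean k z / (z 0 i + k) * (w + n%:R * (z 0 i + k) * p i).
Proof.
move=> k0 zc; rewrite /touching partial_mul_quad /slope; field.
by rewrite !gt_eqF// shifted_coord_gt0.
Qed.

Lemma pos_partM (a b : R) : 0 <= a -> pos_part (a * b) = a * pos_part b.
Proof. by move=> a0; rewrite /pos_part maxr_pMr// mulr0. Qed.

(** The i-th derivative at [z] is the i-th factor of the transformed equation times
    mean / (z_i + k), and the product of these weights is 1 since the n-th power
    of the mean is the product of the z_i + k.  This is why [regularized] solves
    the transformed equation with no error term. *)
Lemma P1_operator_touching k w p c b z : 0 < k -> closed_cube z ->
  P1_operator (touching k w p c b z) z =
  \prod_(i < n) pos_part (w + n%:R * (z 0 i + k) * p i).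
Proof.
move=> k0 zc; rewrite /P1_operator.
under eq_bigr => i _.
  rewrite partial_touching// pos_partM; last first.
    by rewrite divr_ge0// ltW// ?shifted_mean_gt0// shifted_coord_gt0.
  over.
rewrite big_split/= prodf_div prodr_const card_ord shifted_mean_exp//.
by rewrite mulfV ?mul1r// gt_eqF// shifted_prod_gt0.
Qed.

Lemma regularized_mul u th k y : 0 < k -> closed_cube y ->
  u y + th = n%:R * shifted_mean k y * regularized u th k y.
Proof.
move=> k0 yc; have m0 := shifted_mean_gt0 k0 yc.
by rewrite /regularized; field; rewrite !gt_eqF.
Qed.

(** Here u >= 0 is needed: it makes the quadratic touching [regularized]
    nonnegative, so that the mean in front of it may be enlarged. *)
Lemma regularized_subsolution f u k z p c :
  P1_viscosity_solution f u -> (forall y, closed_cube y -> 0 <= u y) ->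
  0 < k -> half_open_cube z ->
  (forall y, closed_cube y ->
     regularized u 0 k y <= quad (regularized u 0 k z) p c z y) ->
  \prod_(i < n) pos_part (regularized u 0 k z + n%:R * (z 0 i + k) * p i) <= f z.
Proof.
move=> [_ _ sub _] u_ge0 k0 zh touch; have zc := half_open_sub_closed zh.
rewrite -(P1_operator_touching _ p c (fun=> 0))//; apply: sub => //.
  exact: mul_quad_C1.
rewrite /local_max_within near_withinE.
apply: filterE => y /half_open_sub_closed yc.
rewrite !touchingE !quad_center mulr1.
have -> : u z = n%:R * shifted_mean k z * regularized u 0 k z.
  by rewrite -regularized_mul ?addr0.
have -> : u y = n%:R * shifted_mean k y * regularized u 0 k y.
  by rewrite -regularized_mul ?addr0.
rewrite subrr subr_le0 -!mulrA ler_pM2l//.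
have q0 : 0 <= regularized u 0 k y.
  by rewrite divr_ge0 ?addr0 ?u_ge0// mulr_ge0 ?ltW// shifted_mean_gt0.
rewrite mulrA; apply: ler_pM => //; first by rewrite ltW// shifted_mean_gt0.
  exact: shifted_mean_le_tangent.
exact: touch.
Qed.

(** Besides the inequality for the product, each factor is nonnegative; this comes
    from the monotonicity of u and replaces the positive parts.  Adding the
    constant [th] to u does not affect the equation for u. *)
Lemma regularized_supersolution f u th k z p c :
  P1_viscosity_solution f u -> nondecreasing_coordinatewise u ->
  (forall y, closed_cube y -> 0 <= u y) ->
  0 <= th -> 0 < k -> half_open_cube z ->
  (forall y, closed_cube y ->
     quad (regularized u th k z) p c z y <= regularized u th k y) ->
  (forall i, 0 <= regularized u th k z + n%:R * (z 0 i + k) * p i) /\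
  f z <= \prod_(i < n) (regularized u th k z + n%:R * (z 0 i + k) * p i).
Proof.
move=> [_ _ _ super] u_nd u_ge0 th0 k0 zh touch.
have zc := half_open_sub_closed zh.
pose b i := - (2 / (n%:R * (z 0 i + k) ^+ 2)).
pose phi := touching k (regularized u th k z) p c b z.
have C1 : continuously_differentiable phi by exact: mul_quad_C1.
have zmin : local_min_within half_open_cube (fun y => u y - phi y) z.
  have : nbhs z [set y : 'rV[R]_n | forall i, `|y 0 i - z 0 i| <= k / 2].
    have k2 : 0 < k / 2 by rewrite divr_gt0.
    apply/nbhs_ballP; exists (k / 2) => //= y zy i; rewrite distrC ltW//.
    by case: zy => _ /(_ 0 i).
  rewrite /local_min_within near_withinE.
  apply: filterS => y close /half_open_sub_closed yc.
  rewrite /phi !touchingE !quad_center mulr1 -regularized_mul//.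
  have q0 : 0 <= regularized u th k y.
    by rewrite divr_ge0 ?addr_ge0 ?u_ge0// mulr_ge0 ?ltW// shifted_mean_gt0.
  suff : n%:R * (shifted_mean k z * quad 1 (slope k z) b z y)
      * quad (regularized u th k z) p c z y <= u y + th by lra.
  rewrite (regularized_mul u th k0 yc) -!mulrA ler_pM2l// mulrA.
  have p0 := parabola_ge0 k0 zc close.
  have m0 := ltW (shifted_mean_gt0 k0 zc).
  (* where the quadratic is negative the touching inequality is trivial, as
     u + th is nonnegative *)
have [w0|w0] := leP 0 (quad (regularized u th k z) p c z y).
    apply: ler_pM => //; first exact: mulr_ge0.
      exact: shifted_mean_ge_parabola.
    exact: touch.
  apply: le_trans (_ : 0 <= _); last first.
    by rewrite mulr_ge0// ltW// shifted_mean_gt0.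
  by apply: mulr_ge0_le0; [exact: mulr_ge0|exact: ltW].
have factor_ge0 i : 0 <= regularized u th k z + n%:R * (z 0 i + k) * p i.
  have := partial_ge0_at_local_min u_nd zh ((C1 i).1 z) zmin.
  rewrite partial_touching// pmulr_rge0// divr_gt0 ?shifted_mean_gt0//.
  exact: shifted_coord_gt0.
split=> //; apply: le_trans (super _ _ zh C1 zmin) _.
rewrite P1_operator_touching// le_eqVlt; apply/orP; left; apply/eqP.
by apply: eq_bigr => i _; rewrite /pos_part max_l.
Qed.

End Regularized.

(** * Compactness and continuity on the cube *)

Section Compactness.
Context {R : realType} (n : nat).
Implicit Types (f g : 'rV[R]_n -> R) (x y z : 'rV[R]_n).

Lemma closed_cube_max g : {within closed_cube, continuous g} ->
  exists2 z, closed_cube z & forall y, closed_cube y -> g y <= g z.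
Proof.
move=> gc; have ne : @closed_cube R n !=set0.
  by exists 0 => i; rewrite mxE lexx ler01.
have [z zc zmax] := EVT_max_rV ne (@compact_closed_cube R n) gc.
exists z; first by move: zc; rewrite inE.
by move=> y yc; apply: zmax; rewrite inE.
Qed.

(** Heine's theorem in coordinates, obtained from the near-covering form of
    compactness with the modulus as the parameter that tends to 0. *)
Lemma uniform_modulus f t : {within closed_cube, continuous f} -> 0 < t ->
  exists2 r, 0 < r & forall x y, closed_cube x -> closed_cube y ->
    (forall i, `|x 0 i - y 0 i| < r) -> `|f x - f y| < t.
Proof.
move=> /subspace_continuousP fc t0.
have t2 : 0 < t / 2 by rewrite divr_gt0.
pose P (r : R) x := closed_cube x -> forall y, closed_cube y ->
  (forall i, `|x 0 i - y 0 i| < r) -> `|f x - f y| < t.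
have /compact_near_coveringP cov := @compact_closed_cube R n.
have : \forall r \near 0^'+, closed_cube `<=` P r.
  apply: cov => z zc.
  have /cvgrPdist_lt /(_ _ t2) := fc z zc.
  rewrite near_withinE => /nbhs_ballP[d /= d0 zd].
  have d2 : 0 < d / 2 by rewrite divr_gt0.
  exists (ball z (d / 2), [set r | r < d / 2]) => /=.
    by split; [exact: nbhsx_ballx|exact: nbhs_right_lt].
  move=> [x r] /= [[_ zx] rd] xc y yc xy.
  have zfx : `|f z - f x| < t / 2.
    apply: zd xc; split=> // i j; apply: le_ball (zx i j).
    by rewrite ler_pdivrMr// ler_pMr// ler1n.
  have zfy : `|f z - f y| < t / 2.
    apply: zd yc; split=> // i j; rewrite (splitr d) ord1.
    apply: ball_triangle (zx 0 j) _; rewrite /ball/=.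
    exact: lt_trans (xy j) rd.
  rewrite (splitr t) (le_lt_trans (ler_distD (f z) _ _))//.
  by rewrite ltrD// distrC.
move=> Pnear; have [r [r0 rP]] : exists r : R, 0 < r /\ closed_cube `<=` P r.
  near (0 : R)^'+ => r; exists r; split; first by near: r; exact: nbhs_right_gt.
  by near: r.
by exists r => // x y xc yc xy; exact: (rP x xc xc y yc xy).
Unshelve. all: by end_near. Qed.

Lemma continuous_shifted_mean k z : 0 < k -> closed_cube z ->
  @shifted_mean R n k @ z --> shifted_mean k z.
Proof.
move=> k0 zc.
have P0 := shifted_prod_gt0 k0 zc.
have cP : (fun y : 'rV[R]_n => \prod_(i < n) (y 0 i + k)) @ z
    --> \prod_(i < n) (z 0 i + k).
  apply: (cvg_big (P := xpredT) mul_continuous (nbhs_filter z)) => i _.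
  exact: cvgD (@coord_continuous R 1 n 0 i z) (cvg_cst _).
have cpow : {for \prod_(i < n) (z 0 i + k), continuous (@powR R ^~ n%:R^-1)}.
  apply/differentiable_continuous/derivable1_diffP.
  by have [] := @is_derive1_powR R n%:R^-1 _ P0.
exact: (@cvg_comp _ _ _ _ (@powR R ^~ n%:R^-1) _ _ _ cP cpow).
Qed.

Lemma continuous_regularized u th k : (1 <= n)%N -> 0 < k ->
  {within closed_cube, continuous u} ->
  {within closed_cube, continuous (@regularized R n u th k)}.
Proof.
move=> n1 k0 /subspace_continuousP uc; apply/subspace_continuousP => z zc.
have m0 := shifted_mean_gt0 k0 zc.
have cm : @shifted_mean R n k @ within closed_cube (nbhs z)
    --> shifted_mean k z.
  by apply: cvg_within_filter; exact: continuous_shifted_mean.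
have cu := uc z zc.
apply: cvgM; first exact: cvgD cu (cvg_cst _).
apply: cvgV; first by rewrite mulf_neq0 ?gt_eqF// ltr0n.
exact: cvgM (cvg_cst _) cm.
Qed.

End Compactness.

(** * Quadratic penalization on the grid *)

Section Grid.
Context {R : realType} (n : nat).
Implicit Types (x y z : 'rV[R]_n) (h e : R).

Lemma grid_max h (Psi : 'rV[R]_n -> R) : 0 < h ->
  exists2 z, grid closed_cube h z &
    forall x, grid closed_cube h x -> Psi x <= Psi z.
Proof.
move=> h0; pose N := Num.bound h^-1.
pose pt (k : {ffun 'I_n -> 'I_N.+1}) : 'rV[R]_n :=
  \row_i (h * (k i : nat)%:R).
have pt_grid k : closed_cube (pt k) -> grid closed_cube h (pt k).
  by split=> // i; exists (k i : nat)%:Z; rewrite mxE.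
have grid_pt x : grid closed_cube h x -> exists k, x = pt k.
  move=> [xc xl].
  have ex i : exists m : 'I_N.+1, x 0 i = h * (m : nat)%:R.
    have [z xi] := xl i; have /andP[x0 x1] := xc i.
    have z0 : (0 <= z)%R by move: x0; rewrite xi pmulr_rge0// ler0z.
    case: z z0 xi => // m _ xi.
    have mN : (m < N.+1)%N.
      rewrite ltnS -(ler_nat R) ltW//.
      apply: le_lt_trans (archi_boundP _); last by rewrite invr_ge0 ltW.
      by rewrite -[leRHS]mulr1 ler_pdivlMl// -xi.
    by exists (Ordinal mN).
  exists [ffun i => projT1 (cid (ex i))].
  apply/rowP => i; rewrite mxE ffunE; exact: projT2 (cid (ex i)).
pose k0 : {ffun 'I_n -> 'I_N.+1} := [ffun=> ord0].
have k0c : `[< closed_cube (pt k0) >].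
  by apply/asboolP => i; rewrite !mxE ffunE mulr0 lexx ler01.
case: (Order.TotalTheory.arg_maxP (P := fun k => `[< closed_cube (pt k) >])
  (fun k => Psi (pt k)) k0c) => k /asboolP kc kmax.
exists (pt k); first exact: pt_grid.
move=> x xg; have [j xj] := grid_pt _ xg; rewrite xj; apply: kmax.
by apply/asboolP; rewrite -xj; case: xg.
Qed.

(** |x - y|^2 / (2 e), written as a [quad] in [y] so that its continuity and its
    expansions come from those of [quad]. *)
Definition penalty e x y : R := quad 0 (fun=> 0) (fun=> (2 * e)^-1) x y.

Lemma penaltyE e x y : penalty e x y = \sum_i (2 * e)^-1 * (y 0 i - x 0 i) ^+ 2.
Proof.
by rewrite /penalty /quad add0r; apply: eq_bigr => i _; rewrite mul0r add0r.
Qed.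

Lemma penalty_diag e x : penalty e x x = 0.
Proof. exact: quad_center. Qed.

Lemma penalty_ge e x y i : 0 < e ->
  (2 * e)^-1 * (y 0 i - x 0 i) ^+ 2 <= penalty e x y.
Proof.
move=> e0; have e2 : 0 <= (2 * e)^-1 by rewrite invr_ge0 mulr_ge0// ltW.
rewrite penaltyE (bigD1 i)//= lerDl sumr_ge0// => j _.
by rewrite mulr_ge0// sqr_ge0.
Qed.

Lemma penalty_ge0 e x y : 0 < e -> 0 <= penalty e x y.
Proof.
move=> e0; rewrite penaltyE sumr_ge0// => j _.
by rewrite mulr_ge0 ?sqr_ge0// invr_ge0 mulr_ge0// ltW.
Qed.

(** Seen from [z], the penalty is a quadratic with gradient (z - x) / e: this is
    the test function in the continuous variable. *)
Lemma penalty_recenter e x y z : 0 < e ->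
  penalty e x y = quad (penalty e x z) (fun i => (z 0 i - x 0 i) / e)
                       (fun=> (2 * e)^-1) z y.
Proof.
move=> e0; rewrite /quad !penaltyE -big_split/=; apply: eq_bigr => i _.
by field; rewrite gt_eqF.
Qed.

(** The discrete counterpart of [penalty_recenter]: a step of the scheme sees the
    same gradient, up to the term h^2 / (2 e). *)
Lemma penalty_step e h x y i : 0 < e ->
  penalty e (x - h *: unit_vec i) y =
  penalty e x y + h * (y 0 i - x 0 i) / e + h ^+ 2 / (2 * e).
Proof.
move=> e0; rewrite !penaltyE (bigD1 i)// [in RHS](bigD1 i)//=.
rewrite !mxE !eqxx/= (eq_bigr (fun j => (2 * e)^-1 * (y 0 j - x 0 j) ^+ 2)).
  by field; rewrite gt_eqF.
by move=> j /negbTE ji; rewrite !mxE ji andbF/= mulr0 subr0.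
Qed.

(** Maximize in [y] by compactness for each grid point, then over the finite
    grid. *)
Lemma doubling_max e h (a b : 'rV[R]_n -> R) : 0 < h ->
  {within closed_cube, continuous b} ->
  exists x0 y0, [/\ grid closed_cube h x0, closed_cube y0 &
    forall x y, grid closed_cube h x -> closed_cube y ->
      a x + b y - penalty e x y <= a x0 + b y0 - penalty e x0 y0].
Proof.
move=> h0 bc.
have ex x : exists z, closed_cube z /\ forall y, closed_cube y ->
    b y - penalty e x y <= b z - penalty e x z.
  have [|z zc zmax] := @closed_cube_max R n (fun y => b y - penalty e x y).
    apply/subspace_continuousP => z zc.
    have /subspace_continuousP/(_ z zc) cb := bc.
    apply: cvgB => //; apply: cvg_within_filter; exact: continuous_quad.
  by exists z.
pose Y x := projT1 (cid (ex x)).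
have YP x : closed_cube (Y x) /\ forall y, closed_cube y ->
    b y - penalty e x y <= b (Y x) - penalty e x (Y x).
  exact: projT2 (cid (ex x)).
have [x0 x0g x0max] :=
  grid_max (fun x => a x + (b (Y x) - penalty e x (Y x))) h0.
exists x0, (Y x0); split=> //; first by have [] := YP x0.
move=> x y xg yc; rewrite -!addrA; apply: le_trans (x0max x xg).
by rewrite lerD2l; exact: (YP x).2.
Qed.

End Grid.

(** * The scheme *)

Section SchemeFacts.
Context {R : realType} (n : nat) (n_ge1 : (1 <= n)%N).
Implicit Types (f w : 'rV[R]_n -> R) (x y z : 'rV[R]_n) (h e : R).

Let n_gt0 : 0 < n%:R :> R. Proof. by rewrite ltr0n. Qed.

Definition scheme_factor h w x (i : 'I_n) : R :=
  w x + if x 0 i == 0 then 0 else n%:R * x 0 i * backward_diff h i w x.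

Lemma grid_neighbor h x i : 0 < h -> grid closed_cube h x -> x 0 i != 0 ->
  grid closed_cube h (x - h *: unit_vec i).
Proof.
move=> h0 [xc xl] xi.
have E j : (x - h *: unit_vec i) 0 j = x 0 j - h * (j == i)%:R.
  by rewrite !mxE eqxx.
split=> j; rewrite E; have [->|_] := eqVneq j i; rewrite ?mulr1 ?mulr0 ?subr0 //.
  have /andP[x0 x1] := xc i; have [k xk] := xl i.
  suff : h <= x 0 i by move=> hx; apply/andP; split; lra.
  have : 0 < x 0 i by rewrite lt_neqAle eq_sym xi.
  rewrite xk pmulr_rgt0// ltr0z => k0.
  by rewrite ler_pMr// ler1z -gtz0_ge1.
by have [k xk] := xl i; exists (k - 1); rewrite xk intrB mulrBr mulr1.
Qed.

Lemma scheme_factor_update h w x i t : 0 < h ->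
  scheme_factor h [eta w with x |-> t] x i =
  scheme_factor h w x i + (t - w x) * (1 + n%:R * x 0 i / h).
Proof.
move=> h0; rewrite /scheme_factor /= eqxx.
case: eqP => [->|_]; first by field; rewrite gt_eqF.
rewrite /backward_diff /= eqxx.
have -> : (x - h *: unit_vec i == x) = false.
  apply/negbTE/eqP => /rowP/(_ i); rewrite !mxE !eqxx/= => /eqP.
  by rewrite mulr1 -subr_eq0 addrAC subrr add0r oppr_eq0 gt_eqF.
by field; rewrite gt_eqF.
Qed.

(** If a factor is negative then f vanishes at [x], and raising the value at [x]
    until that factor becomes 0 gives a larger solution of the equation, against
    maximality. *)
Lemma scheme_factor_ge0 h f w x i : 0 < h -> S3_maximal_solution h f w ->
  grid closed_cube h x -> 0 <= scheme_factor h w x i.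
Proof.
move=> h0 wmax xg; have [_ weq wlargest] := wmax x xg.
rewrite leNgt; apply/negP => neg.
pose D := 1 + n%:R * x 0 i / h.
have D0 : 0 < D.
  have /andP[x0 _] := xg.1 i.
  by rewrite ltr_wpDr// divr_ge0 ?mulr_ge0// ltW.
pose t := w x - scheme_factor h w x i / D.
suff : t <= w x by rewrite gerBl leNgt pmulr_llt0 ?invr_gt0// neg.
apply: wlargest; rewrite -weq.
have zero g : pos_part (scheme_factor h g x i) = 0 -> S3_operator h g x = 0.
  by rewrite /S3_operator (bigD1 i)//= => ->; rewrite mul0r.
rewrite !zero//; first by rewrite /pos_part max_r// ltW.
rewrite scheme_factor_update// -/D /pos_part (_ : _ + _ = 0) ?maxxx//.
by rewrite /t; field; rewrite gt_eqF.
Qed.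

Lemma scheme_prod h f w x : 0 < h -> S3_maximal_solution h f w ->
  grid closed_cube h x -> \prod_(i < n) scheme_factor h w x i = f x.
Proof.
move=> h0 wmax xg; have [_ <- _] := wmax x xg.
apply: eq_bigr => i _; rewrite /pos_part max_l//.
exact: (scheme_factor_ge0 _ h0 wmax xg).
Qed.

Lemma le_of_exp_le (t F : R) : 0 <= t -> 0 <= F -> t ^+ n <= F -> t <= 1 + F.
Proof.
move=> t0 F0 tF; have [t1|t1] := leP t 1; first by lra.
apply: le_trans (_ : F <= _); last by lra.
by apply: le_trans tF; rewrite ler_eXnr// ltW.
Qed.

(** At a maximum over the grid the backward differences are nonnegative, so that
    every factor of the scheme is at least the value of [w] there. *)
Lemma scheme_bounded h f w F : 0 < h -> S3_maximal_solution h f w -> 0 <= F ->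
  (forall x, closed_cube x -> f x <= F) ->
  forall x, grid closed_cube h x -> w x <= 1 + F.
Proof.
move=> h0 wmax F0 fF x xg.
have [z zg zmax] := grid_max w h0.
apply: le_trans (zmax x xg) _.
have [wz0 _ _] := wmax z zg.
apply: le_of_exp_le => //; apply: le_trans (fF z zg.1).
rewrite -(scheme_prod h0 wmax zg) -[in n in _ ^+ n](card_ord n) -prodr_const.
apply: ler_prod => i _; rewrite wz0/= /scheme_factor lerDl.
case: eqVneq => // zi; have /andP[z0 _] := zg.1 i.
apply: mulr_ge0; first by rewrite mulr_ge0.
apply: divr_ge0; last exact: ltW.
by rewrite subr_ge0; apply: zmax; exact: grid_neighbor.
Qed.

(** At a maximum on the cube constants are admissible test functions, and the
    equation bounds the n-th power of the maximum by [F]. *)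
Lemma regularized_le u f k F : P1_viscosity_solution f u ->
  (forall x, closed_cube x -> 0 <= u x) -> 0 < k -> 0 <= F ->
  (forall x, closed_cube x -> f x <= F) ->
  forall y, closed_cube y -> regularized u 0 k y <= 1 + F.
Proof.
move=> usol u_ge0 k0 F0 fF y yc; have [ucont u0 _ _] := usol.
have qcont := continuous_regularized (th := 0) n_ge1 k0 ucont.
have [z zc zmax] := closed_cube_max qcont.
apply: le_trans (zmax y yc) _.
have [zh|[i zi]] := closed_half_open_or_zero zc; last first.
  rewrite /regularized (u0 z (Gamma_face zc zi)) add0r mul0r; lra.
have q0 : 0 <= regularized u 0 k z.
  by rewrite divr_ge0 ?addr0 ?u_ge0// mulr_ge0 ?ltW// shifted_mean_gt0.
apply: le_of_exp_le => //; apply: le_trans (fF z zc).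
have := @regularized_subsolution R n n_ge1 f u k z (fun=> 0) (fun=> 0)
  usol u_ge0 k0 zh.
rewrite -[in n in _ ^+ n](card_ord n) -prodr_const => sub.
apply: le_trans (sub _); last first.
  move=> x xc; rewrite /quad big1 ?addr0; first exact: zmax.
  by move=> j _; rewrite !mul0r addr0.
apply: ler_prod => i _; rewrite q0 mulr0 addr0 /pos_part le_max lexx//.
Qed.

End SchemeFacts.

(** * The doubling argument *)

Section Doubling.
Context {R : realType} (n : nat) (n_ge1 : (1 <= n)%N).
Variables (f u wh : 'rV[R]_n -> R) (h e k eta : R).
Hypotheses (h_gt0 : 0 < h) (e_gt0 : 0 < e) (k_gt0 : 0 < k) (eta_gt0 : 0 < eta).
Hypotheses (usol : P1_viscosity_solution f u)
  (u_nd : nondecreasing_coordinatewise u)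
  (u_ge0 : forall y, closed_cube y -> 0 <= u y)
  (wmax : S3_maximal_solution h f wh).
Hypotheses (k_small : n%:R * k / e <= eta / 8)
  (h_small : n%:R * h / (2 * e) <= eta / 8).
Variables (x0 y0 : 'rV[R]_n).
Hypotheses (x0g : grid closed_cube h x0) (y0h : half_open_cube y0).

Let n_gt0 : 0 < n%:R :> R. Proof. by rewrite ltr0n. Qed.

(** The penalty touches the regularized solution from below at [y0], whence the
    supersolution inequality; maximality in [x] bounds the backward differences
    of [wh] from below by the same slope. *)
Lemma doubling_upper th : 0 <= th ->
  (forall x y, grid closed_cube h x -> closed_cube y ->
     wh x - regularized u th k y - penalty e x y <=
     wh x0 - regularized u th k y0 - penalty e x0 y0) ->
  eta / 2 <= wh x0 - regularized u th k y0 - penalty e x0 y0 ->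
  f y0 + (eta / 4) ^+ n <= f x0.
Proof.
move=> th0 mx gap; have y0c := half_open_sub_closed y0h.
pose p i := - ((y0 0 i - x0 0 i) / e).
have [|A_ge0 fA] := @regularized_supersolution R n n_ge1 f u th k y0 p
  (fun=> - (2 * e)^-1) usol u_nd u_ge0 th0 k_gt0 y0h.
  move=> y yc; have := mx x0 y x0g yc.
  rewrite (penalty_recenter x0 y y0 e_gt0) /quad.
  rewrite (_ : \sum_i (p i * _ + _) =
    - \sum_i ((y0 0 i - x0 0 i) / e * (y 0 i - y0 0 i)
             + (2 * e)^-1 * (y 0 i - y0 0 i) ^+ 2)); last first.
    by rewrite -sumrN; apply: eq_bigr => i _; rewrite /p; ring.
  lra.
rewrite -(scheme_prod h_gt0 wmax x0g).
apply: le_trans (lerD fA (lexx _)) _.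
apply: le_trans (prod_add_ge n_ge1 A_ge0 _) _; first by rewrite divr_ge0// ltW.
apply: ler_prod => i _; apply/andP; split.
  by rewrite addr_ge0// divr_ge0// ltW.
have /andP[xi0 xi1] := x0g.1 i; have /andP[yi0 yi1] := y0c i.
have low : wh x0 + n%:R * x0 0 i * ((x0 0 i - y0 0 i) / e)
    - n%:R * h / (2 * e) <= scheme_factor h wh x0 i.
  rewrite /scheme_factor -addrA lerD2l.
  case: eqVneq => [->|xi].
    by rewrite mulr0 mul0r add0r oppr_le0 divr_ge0 ?mulr_ge0// ltW.
  have step : (x0 0 i - y0 0 i) / e - h / (2 * e) <= backward_diff h i wh x0.
    rewrite /backward_diff ler_pdivlMr//.
    have := mx _ y0 (grid_neighbor h_gt0 x0g xi) y0c.
    rewrite penalty_step// => st.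
    rewrite (_ : _ * h = - (h * (y0 0 i - x0 0 i) / e + h ^+ 2 / (2 * e))).
      by lra.
    by field; rewrite gt_eqF.
  apply: le_trans (ler_wpM2l _ step); last by rewrite mulr_ge0// ltW.
  rewrite mulrBr lerD2l lerN2 -!mulrA ler_pM2l//.
  by rewrite ler_piMl// divr_ge0 ?mulr_ge0// ltW.
apply: le_trans low.
have pen0 := penalty_ge0 x0 y0 e_gt0.
have sq : 0 <= n%:R * ((x0 0 i - y0 0 i) ^+ 2 / e).
  by rewrite mulr_ge0 ?divr_ge0 ?sqr_ge0// ltW.
have ke : n%:R * k * ((x0 0 i - y0 0 i) / e) <= n%:R * k / e.
  rewrite mulrA ler_pM2r ?invr_gt0// ler_piMr//; last by lra.
  by rewrite mulr_ge0// ltW.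
have -> : n%:R * (y0 0 i + k) * p i =
  n%:R * x0 0 i * ((x0 0 i - y0 0 i) / e) - n%:R * ((x0 0 i - y0 0 i) ^+ 2 / e)
  + n%:R * k * ((x0 0 i - y0 0 i) / e) by rewrite /p; ring.
(* the inequality is linear in the following products *)
move: gap pen0 sq ke k_small h_small.
move: (n%:R * _) (n%:R * k * _) (n%:R * k / e) (n%:R * h / _).
move: (n%:R * x0 0 i * _) (penalty _ _ _) (regularized _ _ _ _) (wh x0) => *.
lra.
Qed.

(** The mirror image of [doubling_upper]: the subsolution inequality at [y0], and
    backward differences of [wh] bounded from above. *)
Lemma doubling_lower :
  (forall x y, grid closed_cube h x -> closed_cube y ->
     regularized u 0 k y - wh x - penalty e x y <=
     regularized u 0 k y0 - wh x0 - penalty e x0 y0) ->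
  eta / 2 <= regularized u 0 k y0 - wh x0 - penalty e x0 y0 ->
  f x0 + (eta / 4) ^+ n <= f y0.
Proof.
move=> mx gap; have y0c := half_open_sub_closed y0h.
pose p i := (y0 0 i - x0 0 i) / e.
have := @regularized_subsolution R n n_ge1 f u k y0 p
  (fun=> (2 * e)^-1) usol u_ge0 k_gt0 y0h.
move=> sub; apply: le_trans (sub _); last first.
  move=> y yc; have := mx x0 y x0g yc.
  rewrite (penalty_recenter x0 y y0 e_gt0) /quad /p; lra.
rewrite -(scheme_prod h_gt0 wmax x0g).
have B_ge0 i := scheme_factor_ge0 i h_gt0 wmax x0g.
apply: le_trans (prod_add_ge n_ge1 B_ge0 _) _; first by rewrite divr_ge0// ltW.
apply: ler_prod => i _; apply/andP; split.
  by rewrite addr_ge0// divr_ge0// ltW.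
rewrite /pos_part le_max; apply/orP; left.
have /andP[xi0 xi1] := x0g.1 i; have /andP[yi0 yi1] := y0c i.
have up : scheme_factor h wh x0 i <=
    wh x0 + n%:R * x0 0 i * p i + n%:R * h / (2 * e).
  rewrite /scheme_factor -addrA lerD2l.
  case: eqVneq => [->|xi].
    by rewrite mulr0 mul0r add0r divr_ge0 ?mulr_ge0// ltW.
  have step : backward_diff h i wh x0 <= p i + h / (2 * e).
    rewrite /backward_diff ler_pdivrMr//.
    have := mx _ y0 (grid_neighbor h_gt0 x0g xi) y0c.
    rewrite penalty_step// => st.
    rewrite (_ : _ * h = h * (y0 0 i - x0 0 i) / e + h ^+ 2 / (2 * e)).
      by lra.
    by rewrite /p; field; rewrite gt_eqF.
  apply: le_trans (ler_wpM2l _ step) _; first by rewrite mulr_ge0// ltW.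
  rewrite mulrDr lerD2l -!mulrA ler_pM2l//.
  by rewrite ler_piMl// divr_ge0 ?mulr_ge0// ltW.
apply: (le_trans (lerD up (lexx _))).
have pen0 := penalty_ge0 x0 y0 e_gt0.
have sq : 0 <= n%:R * ((y0 0 i - x0 0 i) ^+ 2 / e).
  by rewrite mulr_ge0 ?divr_ge0 ?sqr_ge0// ltW.
have ke : n%:R * k * ((x0 0 i - y0 0 i) / e) <= n%:R * k / e.
  rewrite mulrA ler_pM2r ?invr_gt0// ler_piMr//; last by lra.
  by rewrite mulr_ge0// ltW.
have -> : n%:R * (y0 0 i + k) * p i =
  n%:R * x0 0 i * p i + n%:R * ((y0 0 i - x0 0 i) ^+ 2 / e)
  - n%:R * k * ((x0 0 i - y0 0 i) / e) by rewrite /p; ring.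
(* the inequality is linear in the following products *)
move: gap pen0 sq ke k_small h_small.
move: (n%:R * _) (n%:R * k * _) (n%:R * k / e) (n%:R * h / _).
move: (n%:R * x0 0 i * _) (penalty _ _ _) (regularized _ _ _ _) (wh x0) => *.
lra.
Qed.

End Doubling.

(** * Letting the regularization vanish *)

Section Shift.
Context {R : realType} (n : nat) (n_ge1 : (1 <= n)%N).
Implicit Types (u : 'rV[R]_n -> R) (x y : 'rV[R]_n) (k th : R).

Let n_gt0 : 0 < n%:R :> R. Proof. by rewrite ltr0n. Qed.

Lemma half_open_prod_gt0 x : half_open_cube x -> 0 < \prod_(i < n) (x 0 i + 0).
Proof.
by move=> xc; apply: prodr_gt0 => i _; rewrite addr0; have /andP[] := xc i.
Qed.

Lemma shifted_mean0_gt0 x : half_open_cube x -> 0 < shifted_mean 0 x.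
Proof. by move=> xc; rewrite powR_gt0// half_open_prod_gt0. Qed.

Lemma regularized0E u x : half_open_cube x ->
  regularized u 0 0 x = n%:R^-1 * (\prod_(i < n) x 0 i) `^ (- n%:R^-1) * u x.
Proof.
move=> xc; rewrite /regularized /shifted_mean addr0 invfM powRN mulrC.
by congr (_ * _^-1 * _); congr (_ `^ _); apply: eq_bigr => i _; rewrite addr0.
Qed.

Lemma le_shifted_mean k x : 0 < k -> half_open_cube x ->
  shifted_mean 0 x <= shifted_mean k x.
Proof.
move=> k0 xh; have xc := half_open_sub_closed xh.
apply: ge0_ler_powR; rewrite ?nnegrE ?invr_ge0//.
- by rewrite ltW// half_open_prod_gt0.
- by rewrite ltW// shifted_prod_gt0.
apply: ler_prod => i _; have /andP[x0 _] := xc i.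
by rewrite addr0 x0 lerDl ltW.
Qed.

Lemma shifted_mean_le_scale k h x : 0 < k -> 0 < h -> half_open_cube x ->
  (forall i, h <= x 0 i) ->
  shifted_mean k x <= (1 + k / h) * shifted_mean 0 x.
Proof.
move=> k0 h0 xh hx; have xc := half_open_sub_closed xh.
have r0 : 0 <= 1 + k / h by rewrite addr_ge0// divr_ge0// ltW.
have <- : ((1 + k / h) ^+ n) `^ n%:R^-1 = 1 + k / h.
  by rewrite -powR_mulrn// -powRrM mulfV ?gt_eqF// powRr1.
have P0 := half_open_prod_gt0 xh.
rewrite /shifted_mean -powRM ?exprn_ge0//; last exact: ltW.
apply: ge0_ler_powR; rewrite ?nnegrE ?invr_ge0//.
- by rewrite ltW// shifted_prod_gt0.
- by apply: mulr_ge0; [exact: exprn_ge0|exact: ltW].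
rewrite -[in n in _ ^+ n](card_ord n) -prodr_const -big_split/=.
apply: ler_prod => i _; have /andP[x0 _] := xc i.
rewrite addr_ge0 ?(ltW k0)//= addr0 mulrDl mul1r lerD2l mulrAC.
by rewrite ler_pdivlMr// ler_pM2l.
Qed.

(** On a face one coordinate contributes only [k], which makes the regularized
    solution large there when k^(1/n) is small compared with th. *)
Lemma shifted_mean_face k y i : 0 < k -> k <= 1 -> closed_cube y -> y 0 i = 0 ->
  shifted_mean k y ^+ n <= k * 2 ^+ n.
Proof.
move=> k0 k1 yc yi; rewrite shifted_mean_exp// (bigD1 i)//= yi add0r ler_pM2l//.
apply: le_trans (_ : \prod_(j < n | j != i) 2 <= _).
  apply: ler_prod => j _; rewrite ltW ?shifted_coord_gt0//=.
  have /andP[_ y1] := yc j; lra.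
rewrite prodr_const ler_weXn2l ?ler1n//.
by rewrite (leq_trans (max_card _))// card_ord.
Qed.

End Shift.

Lemma exists_small (R : realType) (a b : R) : 0 < a -> 0 < b ->
  exists k, [/\ 0 < k, k <= a & k <= b].
Proof.
move=> a0 b0; exists (Num.min a b).
by rewrite lt_min a0 b0 !ge_min !lexx orbT.
Qed.

Section Comparison.
Context {R : realType} (n : nat) (n_ge1 : (1 <= n)%N).
Variables (f u wh : 'rV[R]_n -> R) (h e r F eta : R).
Hypotheses (h_gt0 : 0 < h) (eta_gt0 : 0 < eta) (F_ge0 : 0 <= F) (r_gt0 : 0 < r).
Hypotheses (usol : P1_viscosity_solution f u)
  (u_nd : nondecreasing_coordinatewise u)
  (wmax : S3_maximal_solution h f wh)
  (fF : forall x, closed_cube x -> f x <= F)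
  (f_mod : forall x y, closed_cube x -> closed_cube y ->
    (forall i, `|x 0 i - y 0 i| < r) -> `|f x - f y| < (eta / 4) ^+ n).
Hypotheses (eE : e = r ^+ 2 / (4 * (1 + F)))
  (h_small : n%:R * h / (2 * e) <= eta / 8).
Variable (x : 'rV[R]_n).
Hypothesis (xg : grid half_open_cube h x).

Let n_gt0 : 0 < n%:R :> R. Proof. by rewrite ltr0n. Qed.

Let F1_gt0 : 0 < 1 + F. Proof. by rewrite ltr_wpDr. Qed.

Let e_gt0 : 0 < e.
Proof. by rewrite eE divr_gt0 ?exprn_gt0 ?mulr_gt0. Qed.

Let u_ge0 y : closed_cube y -> 0 <= u y.
Proof. by move=> yc; have [_ u0 _ _] := usol; exact: nondecreasing_ge0. Qed.

Let xcg : grid closed_cube h x.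
Proof. by have [xh xl] := xg; split=> //; exact: half_open_sub_closed. Qed.

Let grid_ge i : h <= x 0 i.
Proof.
have [xh xl] := xg; have [m xm] := xl i; have /andP[+ _] := xh i.
by rewrite xm pmulr_rgt0// ltr0z => m0; rewrite ler_pMr// ler1z -gtz0_ge1.
Qed.

Lemma close_of_penalty_le (y z : 'rV[R]_n) : penalty e y z <= 1 + F ->
  forall i, `|y 0 i - z 0 i| < r.
Proof.
move=> pen i; have := le_trans (penalty_ge y z i e_gt0) pen.
rewrite mulrC ler_pdivrMr ?mulr_gt0// => sq.
rewrite -(@ltr_pXn2r _ 2) ?nnegrE ?(ltW r_gt0)// real_normK ?num_real//.
rewrite -sqrrN opprB; apply: le_lt_trans sq _.
rewrite eE (_ : (1 + F) * _ = r ^+ 2 / 2); last by field; rewrite gt_eqF.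
by rewrite ltr_pdivrMr// ltr_pMr ?exprn_gt0// ltr1n.
Qed.

(** [th] is tuned so that it raises the regularized solution at the given point
    [x] by at most eta / 2, and [g] is the size below which the mean must fall on
    the faces for the regularized solution to exceed the bound 1 + F of [wh]. *)
Lemma scheme_le_solution : wh x <= regularized u 0 0 x + eta.
Proof.
rewrite leNgt; apply/negP => gap; have [xh _] := xg.
have m0 := shifted_mean0_gt0 xh.
pose th := eta / 2 * (n%:R * shifted_mean 0 x).
have th0 : 0 < th by rewrite !mulr_gt0// invr_gt0.
pose g := th / (n%:R * (1 + F)).
have g0 : 0 < g by rewrite divr_gt0// mulr_gt0.
have [||k1 [k10 k1e k1g]] := @exists_small R (eta / 8 * e / n%:R)
    (g ^+ n / (2 * 2 ^+ n)).
- by rewrite !mulr_gt0// invr_gt0.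
- by rewrite divr_gt0 ?mulr_gt0 ?exprn_gt0.
have [k [k0 kk1 k_le1]] := exists_small k10 (@ltr01 R).
have ke : n%:R * k / e <= eta / 8.
  rewrite ler_pdivrMr// mulrC -ler_pdivlMr//; exact: le_trans kk1 k1e.
have [ucont u0 _ _] := usol.
have qcont := continuous_regularized (th := th) n_ge1 k0 ucont.
have Nqcont : {within closed_cube, continuous (fun y => - regularized u th k y)}.
  by move=> z; apply: continuousN => ?; exact: qcont.
have [x0 [y0 [x0g y0c mx]]] := doubling_max e wh h_gt0 Nqcont.
have top : eta / 2 <= wh x0 - regularized u th k y0 - penalty e x0 y0.
  apply: le_trans (mx x x xcg xcg.1); rewrite penalty_diag subr0.
  have mk := shifted_mean_gt0 k0 xcg.1.
  have m0k := le_shifted_mean k0 xh.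
  have : regularized u th k x <= regularized u 0 0 x + eta / 2.
    rewrite /regularized addr0 mulrDl; apply: lerD.
      apply: ler_pM; rewrite ?invr_ge0 ?mulr_ge0 ?u_ge0 ?powR_ge0//.
        exact: xcg.1.
      by rewrite lef_pV2 ?posrE ?mulr_gt0// ler_pM2l.
    by rewrite ler_pdivrMr ?mulr_gt0// ler_pM2l ?divr_gt0// ler_pM2l.
  by move: gap; lra.
have pen0 := penalty_ge0 x0 y0 e_gt0.
have whF := scheme_bounded n_ge1 h_gt0 wmax F_ge0 fF x0g.
have q0 : 0 <= regularized u th k y0.
  rewrite divr_ge0 ?addr_ge0 ?u_ge0// ?(ltW th0)//.
  by rewrite mulr_ge0// powR_ge0.
have [y0h|[i yi]] := closed_half_open_or_zero y0c; last first.
  have : 1 + F < regularized u th k y0.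
    rewrite /regularized (u0 _ (Gamma_face y0c yi)) add0r.
    have my := shifted_mean_gt0 k0 y0c.
    suff mg : shifted_mean k y0 < g.
      rewrite ltr_pdivlMr ?mulr_gt0// (_ : th = (1 + F) * (n%:R * g)).
        by rewrite ltr_pM2l// ltr_pM2l.
      by rewrite /g; field; rewrite !gt_eqF.
    rewrite -(@ltr_pXn2r _ n) ?nnegrE ?ltW//.
    apply: le_lt_trans (shifted_mean_face n_ge1 k0 k_le1 y0c yi) _.
    rewrite -ltr_pdivlMr ?exprn_gt0//; apply: le_lt_trans (le_trans kk1 k1g) _.
    rewrite invfM mulrA mulrAC ltr_pdivrMr// ltr_pMr ?ltr1n//.
    by rewrite divr_gt0 ?exprn_gt0.
  by move: eta_gt0; lra.
have := doubling_upper n_ge1 h_gt0 e_gt0 k0 eta_gt0 usol u_nd u_ge0 wmax ke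
  h_small x0g y0h (ltW th0) mx top.
have := f_mod x0g.1 y0c (@close_of_penalty_le x0 y0 _).
rewrite ltr_norml => /(_ _)/andP[]; first by move: eta_gt0; lra.
lra.
Qed.

(** No vertical shift is needed here (th = 0).  The shift [k] lowers the solution
    at [x] by a factor at most 1 + k / h, because grid points of the half-open
    cube have all coordinates at least [h]. *)
Lemma solution_le_scheme : regularized u 0 0 x <= wh x + eta.
Proof.
rewrite leNgt; apply/negP => gap; have [xh _] := xg.
have m0 := shifted_mean0_gt0 xh.
set w := regularized u 0 0 x in gap.
have w0 : 0 <= w.
  by rewrite /w divr_ge0 ?addr0 ?u_ge0 ?mulr_ge0 ?powR_ge0//; exact: xcg.1.
have [||k [k0 k1e kh]] := @exists_small R (eta / 8 * e / n%:R)
    (eta * h / (2 * (1 + w))).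
- by rewrite !mulr_gt0// invr_gt0.
- by rewrite !mulr_gt0// invr_gt0 mulr_gt0// ltr_wpDr.
have ke : n%:R * k / e <= eta / 8.
  by rewrite ler_pdivrMr// mulrC -ler_pdivlMr.
have [ucont u0 _ _] := usol.
have qcont := continuous_regularized (th := 0) n_ge1 k0 ucont.
have [x0 [y0 [x0g y0c mx']]] := doubling_max e (fun x => - wh x) h_gt0 qcont.
have mx a b : grid closed_cube h a -> closed_cube b ->
    regularized u 0 k b - wh a - penalty e a b <=
    regularized u 0 k y0 - wh x0 - penalty e x0 y0.
  move=> ag bc; rewrite ![regularized _ _ _ _ - _]addrC; exact: mx'.
have top : eta / 2 <= regularized u 0 k y0 - wh x0 - penalty e x0 y0.
  apply: le_trans (mx x x xcg xcg.1); rewrite penalty_diag subr0.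
  suff : w - eta / 2 <= regularized u 0 k x by move: gap; lra.
  have mk := shifted_mean_gt0 k0 xcg.1.
  have scale := shifted_mean_le_scale n_ge1 k0 h_gt0 xh grid_ge.
  have kh0 : 0 < k / h by rewrite divr_gt0.
  have : w <= (1 + k / h) * regularized u 0 k x.
    rewrite /w /regularized mulrA ler_pdivlMr ?mulr_gt0// mulrAC.
    rewrite ler_pdivrMr ?mulr_gt0// [(1 + _) * _]mulrC -!mulrA.
    rewrite ler_wpM2l ?addr0 ?u_ge0//; first exact: xcg.1.
    by rewrite mulrCA ler_pM2l.
  have qw : regularized u 0 k x <= w.
    apply: ler_pM; rewrite ?invr_ge0 ?mulr_ge0 ?addr0 ?u_ge0 ?powR_ge0//.
      exact: xcg.1.
    rewrite lef_pV2 ?posrE ?mulr_gt0//.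
    by rewrite ler_pM2l//; exact: le_shifted_mean.
  have kw : k / h * (1 + w) <= eta / 2.
    rewrite -ler_pdivlMr ?ltr_wpDr// ler_pdivrMr//; apply: le_trans kh _.
    rewrite le_eqVlt; apply/orP; left; apply/eqP; field.
    by rewrite gt_eqF// ltr_wpDr.
  rewrite mulrDl mul1r => wq.
  have : k / h * regularized u 0 k x <= k / h * w by rewrite ler_pM2l.
  by move: kh0 kw wq; rewrite mulrDr mulr1; lra.
have pen0 := penalty_ge0 x0 y0 e_gt0.
have [wh0 _ _] := wmax x0g.
have qF := regularized_le n_ge1 usol u_ge0 k0 F_ge0 fF y0c.
have [y0h|[i yi]] := closed_half_open_or_zero y0c; last first.
  move: top; rewrite /regularized (u0 _ (Gamma_face y0c yi)) add0r mul0r.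
  by move: eta_gt0; lra.
have := doubling_lower n_ge1 h_gt0 e_gt0 k0 eta_gt0 usol u_ge0 wmax ke
  h_small x0g y0h mx top.
have := f_mod x0g.1 y0c (@close_of_penalty_le x0 y0 _).
rewrite ltr_norml => /(_ _)/andP[]; first by move: eta_gt0; lra.
lra.
Qed.

End Comparison.

(** * Convergence *)

Theorem theorem3p9 (R : realType) (n : nat) (n_ge1 : (1 <= n)%N)
  (f : 'rV[R]_n -> R)
  (f_cont : {within closed_cube, continuous f})
  (f_ge0 : forall x, closed_cube x -> 0 <= f x)
  (w : 'rV[R]_n -> R) (w_max : P3_maximal_solution f w)
  (wh : R -> 'rV[R]_n -> R)
  (wh_max : forall h : R, 0 < h -> S3_maximal_solution h f (wh h)) :
  forall eps : R, 0 < eps ->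
    \forall h \near 0^'+,
      forall x : 'rV[R]_n, grid half_open_cube h x -> `|wh h x - w x| <= eps.
Proof.
move=> eps eps0; have [u [usol u_nd wE]] := w_max.
have n0 : 0 < n%:R :> R by rewrite ltr0n.
have [z zc zmax] := closed_cube_max f_cont.
have F0 := f_ge0 z zc.
have d0 : 0 < (eps / 4) ^+ n by rewrite exprn_gt0// divr_gt0.
have [r r0 f_mod] := uniform_modulus f_cont d0.
have [e eE] : exists e, e = r ^+ 2 / (4 * (1 + f z)) by eexists.
have e0 : 0 < e by rewrite eE divr_gt0 ?exprn_gt0 ?mulr_gt0 ?ltr_wpDr.
near=> h => x xg.
have h0 : 0 < h by near: h; exact: nbhs_right_gt.
have hs : n%:R * h / (2 * e) <= eps / 8.
  rewrite ler_pdivrMr; last by rewrite mulr_gt0.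
  rewrite mulrC -ler_pdivlMr//; apply: ltW; near: h; apply: nbhs_right_lt.
  by rewrite !mulr_gt0 ?invr_gt0.
rewrite (wE x xg.1) -regularized0E; last by case: xg.
have up := scheme_le_solution n_ge1 h0 eps0 F0 r0 usol u_nd
  (wh_max h h0) zmax f_mod eE hs xg.
have lo := solution_le_scheme n_ge1 h0 eps0 F0 r0 usol u_nd
  (wh_max h h0) zmax f_mod eE hs xg.
by rewrite ler_norml; apply/andP; split; lra.
Unshelve. all: by end_near. Qed.
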